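(* There exists an absolute constant $C>0$ such that for every odd prime $p$, $$\kappa_p \le C\sqrt{\eta_{0,p}},$$ i.e. $\kappa_p\in O(\sqrt{\eta_{0,p}})$ as $p$ ranges over the odd primes.
   Context: Let $p$ be an odd prime. For an integer $k$ with $k\not\equiv 0 \pmod p$, the Fermat quotient $q_p(k)$ is the unique integer in $\{0,1,\dots,p-1\}$ such that $k^{p-1}\equiv 1+q_p(k)\,p \pmod{p^2}$. Define $\kappa_p:=\min\{n>0 \mid q_p(n)\neq 0\}$. The Mirimanoff polynomial is $\gamma_p(t):=\sum_{j=1}^{p-1} \frac{t^j}{j}$, regarded as a polynomial with coefficients in $\mathbb{F}_p$ (so $1/j$ is the inverse of $j$ modulo $p$). Define $\eta_{0,p}:=|\{c \mid 0\le c<p,\ \gamma_p(c)\equiv 0 \pmod p\}|$. *)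

(* Defs.v *)
From HB Require Import structures.
From mathcomp Require Import all_boot all_order all_algebra all_solvable.
From mathcomp Require Import ring.

Set Implicit Arguments.
Unset Strict Implicit.
Unset Printing Implicit Defensive.

Import Order.TTheory GRing.Theory Num.Theory.
Local Open Scope ring_scope.

Definition is_fermat_quotient (p : nat) (k : int) (q : nat) : bool :=
  (k ^+ p.-1 == 1 + q%:Z * p%:Z %[mod (p ^ 2)%N])%Z.

(* The q in {0, ..., p - 1} with k ^ (p - 1) = 1 + q p mod p ^ 2. For p prime
   it exists and is unique when p does not divide k (see the next two lemmas);
   the default value 0 is a dummy. *)
Definition fermat_quotient (p : nat) (k : int) : nat :=
  if [pick q : 'I_p | is_fermat_quotient p k q] is Some q then val q else 0%N.

Lemma fermat_quotient_eq (p : nat) (k : int) (q : nat) :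
  (q < p)%N -> is_fermat_quotient p k q -> fermat_quotient p k = q.
Proof.
move=> qp kq; rewrite /fermat_quotient; case: pickP => [r kr|/(_ (Ordinal qp))];
  last by rewrite kq.
have p0 : (0 < p)%N by exact: leq_ltn_trans qp.
have : (1 + r%:Z * p%:Z == 1 + q%:Z * p%:Z %[mod (p ^ 2)%N])%Z.
  by rewrite -(eqP kr) (eqP kq).
rewrite eqz_modDl -!PoszM !modz_nat eqz_nat !(expnS p 1) expn1 -!muln_modl.
by rewrite !modn_small // ?eqn_pmul2r // => /eqP.
Qed.

Lemma fermat_quotientP (p : nat) (k : int) : prime p -> ~~ (p%:Z %| k)%Z ->
  (fermat_quotient p k < p)%N /\ is_fermat_quotient p k (fermat_quotient p k).
Proof.
move=> p_pr pk; have p0 := prime_gt0 p_pr.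
suff [q qp kq] : exists2 q, (q < p)%N & is_fermat_quotient p k q.
  by rewrite (fermat_quotient_eq qp kq).
have [m mE] : exists m : nat, (k %% (p ^ 2)%N)%Z = m.
  by exists `|(k %% (p ^ 2)%N)%Z|%N; rewrite gez0_abs // modz_ge0 // eqz_nat
            -lt0n expn_gt0 p0.
have kmp : (k ^+ p.-1 = (m ^ p.-1)%N %[mod (p ^ 2)%N])%Z.
  by rewrite -modzXm mE -[Posz m]natz -natrX natz.
have pm : coprime m p.
  rewrite coprime_sym prime_coprime //; apply: contra pk => pm.
  rewrite (divz_eq k (p ^ 2)%N) mE rpredD //.
  by apply: dvdz_mull; rewrite dvdzE /= dvdn_exp.
have := Euler_exp_totient pm; rewrite totient_prime // => m1.
set r := (m ^ p.-1 %% p ^ 2)%N.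
have r1 : (r %% p = 1)%N.
  by rewrite /r modn_dvdm ?dvdn_exp // m1 modn_small // prime_gt1.
exists (r %/ p)%N.
  by rewrite ltn_divLR // mulnn ltn_pmod // expn_gt0 p0.
rewrite /is_fermat_quotient kmp -PoszM -PoszD !modz_nat eqz_nat.
by rewrite -[in X in (X + _)%N]r1 addnC -divn_eq /r modn_mod.
Qed.

Lemma kappa_subproof (p : nat) : prime p ->
  exists n : nat, [&& (0 < n)%N, ~~ (p %| n)%N & fermat_quotient p n%:Z != 0%N].
Proof.
move=> p_pr; have p1 := prime_gt1 p_pr; have p0 := prime_gt0 p_pr.
exists p.+1; apply/and3P; split => //.
  by rewrite -addn1 dvdn_addr // dvdn1 neq_ltn p1 orbT.
rewrite (@fermat_quotient_eq _ _ p.-1) ?prednK //.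
  by case: p p1 {p_pr p0} => [|[]].
have binom n : ((1 + p%:Z) ^+ n = 1 + n%:Z * p%:Z %[mod (p ^ 2)%N])%Z.
  elim: n => [|n IHn]; first by rewrite expr0 mul0r addr0.
  rewrite exprS -modzMmr IHn modzMmr.
  have -> : (1 + p%:Z) * (1 + n%:Z * p%:Z) =
            n%:Z * (p ^ 2)%N%:Z + (1 + n.+1%:Z * p%:Z).
    by rewrite (expnS p 1) expn1 PoszM intS; ring.
  by rewrite modzMDl.
by rewrite /is_fermat_quotient intS binom.
Qed.

Definition kappa (p : nat) (p_pr : prime p) : nat := ex_minn (kappa_subproof p_pr).

Definition mirimanoff (p : nat) : {poly 'F_p} :=
  \sum_(1 <= j < p) (j%:R)^-1 *: 'X^j.

Definition eta0 (p : nat) : nat :=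
  #|[set c : 'I_p | (mirimanoff p).[(c : nat)%:R] == 0]|.

(* Main.v *)
(** Let N = kappa_p - 1, so that a ^ p = a mod p ^ 2 whenever |a| <= N.

    First, N ^ 2 <= p: otherwise some product of two integers in [1, N] equals
    p + d with 0 < d <= N, and then p + d = (p + d) ^ p = d ^ p = d mod p ^ 2.

    For 1 <= a, b <= N, dividing (b - a) ^ p = b ^ p - a ^ p mod p ^ 2 by p
    shows that a / b is a root of the Mirimanoff polynomial, because
    binomial(p, j) / p = (-1) ^ (j - 1) / j mod p. As N ^ 2 <= p, coprime pairs
    (a, b) give distinct roots. At least N ^ 2 / 4 of the pairs are coprime,
    since the sum of 1 / d ^ 2 over d >= 2 is at most 3 / 4. Hence
    N ^ 2 <= 4 eta_0. *)

Require Import Defs.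
From mathcomp Require Import all_boot all_order all_algebra reals.
From mathcomp Require Import zify ring lra.
Import Order.TTheory GRing.Theory Num.Theory.
Local Open Scope ring_scope.

(** In x ^ p - y ^ p = (x - y) * sum, each of the p terms of the sum is y ^ (p - 1) mod p, so p
    divides both factors. *)
Lemma dvdz_sqr_subX (p : nat) (x y : int) :
  (p%:Z %| x - y)%Z -> ((p ^ 2)%N%:Z %| x ^+ p - y ^+ p)%Z.
Proof.
move=> pxy; rewrite subrXX expnS expn1 PoszM dvdz_mul //.
rewrite -eqz_mod_dvd in pxy.
have -> : \sum_(i < p) x ^+ (p.-1 - i) * y ^+ i =
   \sum_(i < p) (x ^+ (p.-1 - i) - y ^+ (p.-1 - i)) * y ^+ i + p%:Z * y ^+ p.-1.
  transitivity (\sum_(i < p) ((x ^+ (p.-1 - i) - y ^+ (p.-1 - i)) * y ^+ i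
     + y ^+ p.-1)).
    apply: eq_bigr => i _; rewrite mulrBl -exprD subnK ?subrK //.
    by have := ltn_ord i; lia.
  by rewrite big_split /= sumr_const card_ord -mulr_natl natz.
rewrite rpredD ?dvdz_mulr // rpred_sum // => i _.
rewrite dvdz_mulr // -eqz_mod_dvd.
by rewrite -modzXm (eqP pxy) modzXm.
Qed.

(** Minimality of [kappa] gives q_p(a) = 0; since only integers prime to p compete for that minimum,
    [a < p] is assumed as well. *)
Lemma fermat_lt_kappa (p : nat) (p_pr : prime p) (a : nat) :
  (0 < a < kappa p_pr)%N -> (a < p)%N ->
  ((p ^ 2)%N%:Z %| a%:Z ^+ p - a%:Z)%Z.
Proof.
rewrite /kappa; case: ex_minnP => n _ nmin /andP[a0 an] ap.
have pa : ~~ (p %| a)%N by rewrite gtnNdvd.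
have qa : fermat_quotient p a = 0%N.
  apply/eqP; apply: contraTT an => qa; rewrite -leqNgt; apply: nmin.
  by rewrite a0 pa.
have [_] := fermat_quotientP (k := a) p_pr pa.
rewrite qa /is_fermat_quotient mul0r addr0 eqz_mod_dvd => ap1.
have -> : a%:Z ^+ p - a%:Z = a%:Z * (a%:Z ^+ p.-1 - 1).
  by rewrite mulrBr mulr1 -exprS prednK ?prime_gt0.
exact: dvdz_mull.
Qed.

Lemma kappa_gt1 (p : nat) (p_pr : prime p) : (1 < kappa p_pr)%N.
Proof.
rewrite /kappa; case: ex_minnP => -[|[|n]] // /and3P[_ _ /eqP[]].
apply: fermat_quotient_eq; first exact: prime_gt0.
by rewrite /is_fermat_quotient mul0r addr0 expr1n.
Qed.

Lemma kappa_pred_sqr (p : nat) (p_pr : prime p) : odd p ->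
  ((kappa p_pr).-1 ^ 2 <= p)%N.
Proof.
move=> p_odd; rewrite leqNgt; apply/negP => ltpN.
have p3 : (2 < p)%N by rewrite odd_prime_gt2.
(* The minimum keeps m below p, as kappa_p < p is not known yet. *)
pose m := minn (kappa p_pr).-1 p.-1.
have mk : (m < kappa p_pr)%N by have := kappa_gt1 p p_pr; rewrite /m; lia.
have mp : (m < p)%N by rewrite /m; lia.
have pm : (p < m * m)%N.
  rewrite /m /minn; case: ifP => _; first by rewrite mulnn.
  by case: p {p_pr p_odd ltpN m mk mp} p3 => [|[|[|q]]] //= _; nia.
have m0 : (0 < m)%N by lia.
(* The least [a] with a * m > p, so that the excess [d] over p lies in [1, m]. *)
pose a := (p %/ m).+1.
have am : (a <= m)%N by rewrite /a ltn_divLR.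
pose d := (m - p %% m)%N.
have dm : (0 < d <= m)%N by rewrite /d leq_subr subn_gt0 ltn_mod m0.
have amE : (a * m = p + d)%N.
  by rewrite /a /d mulSn; have := divn_eq p m; have := ltn_pmod p m0; lia.
have fix_ x : (0 < x <= m)%N -> ((p ^ 2)%N%:Z %| x%:Z ^+ p - x%:Z)%Z.
  by move=> xm; apply: (@fermat_lt_kappa _ p_pr); lia.
have fa := fix_ a am; have fd := fix_ d dm.
have fm : ((p ^ 2)%N%:Z %| m%:Z ^+ p - m%:Z)%Z by rewrite fix_ // m0 leqnn.
have fpd : ((p ^ 2)%N%:Z %| (p + d)%N%:Z ^+ p - d%:Z ^+ p)%Z.
  by apply: dvdz_sqr_subX; rewrite PoszD addrK.
have : ((p ^ 2)%N%:Z %| p%:Z)%Z.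
  (* Since p + d = a * m, everything cancels except a * m - d, and p ^ 2 divides every summand. *)
  have -> : p%:Z = ((p + d)%N%:Z ^+ p - d%:Z ^+ p) + (d%:Z ^+ p - d%:Z)
     - (a%:Z ^+ p - a%:Z) * m%:Z ^+ p - a%:Z * (m%:Z ^+ p - m%:Z).
    have -> : p%:Z = (a * m)%N%:Z - d%:Z by rewrite amE PoszD addrK.
    by rewrite -amE PoszM exprMn; ring.
  apply: rpredB; last exact: dvdz_mull.
  by apply: rpredB; [exact: rpredD | exact: dvdz_mulr].
by rewrite dvdzE /= gtnNdvd ?(ltn_exp2l 1 2) //; lia.
Qed.

(** By Pascal's rule, consecutive entries of row p - 1 add up to an entry of row p, which vanishes
    mod p. *)
Lemma bin_pred_prime (p i : nat) : prime p -> (i < p)%N ->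
  'C(p.-1, i)%:R = (-1) ^+ i :> 'F_p.
Proof.
move=> p_pr; elim: i => [|i IHi] ip; first by rewrite bin0.
have : 'C(p, i.+1)%:R = 0 :> 'F_p.
  by apply/eqP; rewrite -(dvdn_pcharf (pchar_Fp p_pr)) prime_dvd_bin.
have -> : 'C(p, i.+1) = ('C(p.-1, i.+1) + 'C(p.-1, i))%N.
  by rewrite -binS prednK ?prime_gt0.
rewrite natrD (IHi (ltnW ip)) exprS mulN1r.
by move/eqP; rewrite addr_eq0 => /eqP.
Qed.

Lemma root_mirimanoff (p : nat) (a b : int) : prime p -> odd p ->
    ~~ (p%:Z %| b)%Z ->
    ((p ^ 2)%N%:Z %| (b - a) ^+ p - b ^+ p + a ^+ p)%Z ->
  (mirimanoff p).[a%:~R / b%:~R] = 0.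
Proof.
move=> p_pr p_odd pb pab; have p0 := prime_gt0 p_pr.
have Fint (z : int) : (z%:~R == 0 :> 'F_p) = (p%:Z %| z)%Z.
  case: z => n; rewrite dvdzE /= (dvdn_pcharf (pchar_Fp p_pr)) //.
  by rewrite NegzE mulrNz oppr_eq0.
have b0 : b%:~R != 0 :> 'F_p by rewrite Fint.
pose k j := ('C(p, j) %/ p)%N.
have kE j : (0 < j < p)%N -> 'C(p, j) = (p * k j)%N.
  by move=> jp; rewrite mulnC divnK // prime_dvd_bin.
(* The expansion of (b - a) ^ p without its two outer terms, divided by p. Modulo p it equals - b ^
   p times the Mirimanoff polynomial at a / b. *)
pose S : int := \sum_(1 <= j < p) (k j)%:R * (b ^+ (p - j) * (- a) ^+ j).
have pS : (p%:Z %| S)%Z.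
  rewrite -(@dvdz_mul2l p%:Z) ?eqz_nat -?lt0n // -PoszM mulnn.
  suff -> : p%:Z * S = (b - a) ^+ p - b ^+ p + a ^+ p by [].
  pose t i := b ^+ (p - i) * (- a) ^+ i *+ 'C(p, i).
  rewrite exprDn -(big_mkord xpredT t) big_nat_recr //= big_ltn // /t.
  rewrite subn0 subnn bin0 binn !expr0 mulr1 mul1r !mulr1n.
  rewrite exprNn -signr_odd p_odd expr1 mulN1r.
  rewrite [RHS](_ : _ = \sum_(1 <= i < p) t i).
    rewrite mulr_sumr; apply: eq_big_nat => j jp.
    rewrite /t kE // -[RHS]mulr_natl.
    by rewrite natrM !natz mulrA.
  by rewrite /t; ring.
have : S%:~R = 0 :> 'F_p by apply/eqP; rewrite Fint.
move=> S0; apply: (mulIf b0); apply: (mulIf (expf_neq0 p.-1 b0)).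
rewrite !mul0r -mulrA -exprS prednK // -[RHS]oppr0 -S0 /S.
rewrite /mirimanoff horner_sum mulr_suml rmorph_sum /= -sumrN.
apply: eq_big_nat => j jp.
rewrite hornerZ hornerXn !rmorphM !rmorphXn /= rmorphN /= expr_div_n.
have -> : b%:~R ^+ p = b%:~R ^+ (p - j) * b%:~R ^+ j :> 'F_p.
  by rewrite -exprD subnK // ltnW //; case/andP: jp.
have kj : (k j)%:R * j%:R = - (-1) ^+ j :> 'F_p.
  rewrite -natrM; have -> : (k j * j = 'C(p.-1, j.-1))%N.
    apply/eqP; rewrite -(eqn_pmul2l p0) mulnA -kE // mul_bin_diag.
    by rewrite prednK 1?mulnC; case/andP: jp.
  rewrite bin_pred_prime //; last by lia.
  by case: j jp => // j _; rewrite exprS mulN1r opprK.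
have j0 : j%:R != 0 :> 'F_p.
  by rewrite -(dvdn_pcharf (pchar_Fp p_pr)) gtnNdvd; case/andP: jp.
rewrite (exprNn a%:~R) -[((k j)%:R)%:~R]/((k j)%:R%:~R) rmorph_nat.
have -> : (k j)%:R = - (-1) ^+ j / j%:R :> 'F_p by rewrite -kj mulfK.
have s2 : (-1) ^+ j * (-1) ^+ j = 1 :> 'F_p.
  by rewrite -exprMn mulrNN mulr1 expr1n.
have bj := expf_neq0 j b0.
transitivity (j%:R^-1 * (a%:~R ^+ j * b%:~R ^+ (p - j))
                * ((-1) ^+ j * (-1) ^+ j) : 'F_p).
  by rewrite s2; field; rewrite j0 bj.
by field.
Qed.

Lemma sum_divn_sqr (N : nat) : (0 < N)%N ->
  (4 * \sum_(2 <= d < N.+1) (N %/ d) ^ 2 <= 3 * N ^ 2)%N.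
Proof.
move=> N0.
(* The term 4 / (n + 2) makes the induction work: 1 / d ^ 2 <= 1 / (d - 1) - 1 / d telescopes from
   the exact value 1 / 4 at d = 2. *)
have H n : 4 * \sum_(2 <= d < n.+3) ((N %/ d) ^ 2)%N%:R <=
     N%:R ^+ 2 * (3 - 4 / n.+2%:R) :> rat.
  have sq d : (0 < d)%N -> ((N %/ d) ^ 2)%N%:R <= N%:R ^+ 2 / d%:R ^+ 2 :> rat.
    move=> d0; rewrite ler_pdivlMr ?exprn_gt0 ?ltr0n // natrX -exprMn -natrM.
    by rewrite lerXn2r ?nnegrE ?ler0n // ler_nat leq_divM.
  elim: n => [|n IHn].
    by rewrite big_nat1; have := sq 2%N isT; lra.
  rewrite big_nat_recr //= mulrDr.
  have := sq n.+3 isT => {}sq.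
  have n2 : 0 <= n%:R :> rat by rewrite ler0n.
  apply: (le_trans (lerD IHn (ler_wpM2l _ sq))) => //.
  have -> : n.+2%:R = n%:R + 2 :> rat by rewrite -addn2 natrD.
  have -> : n.+3%:R = n%:R + 3 :> rat by rewrite -addn3 natrD.
  have -> : 4 * (N%:R ^+ 2 / (n%:R + 3) ^+ 2) =
            N%:R ^+ 2 * (4 / (n%:R + 3) ^+ 2) :> rat by ring.
  rewrite -mulrDr ler_wpM2l ?sqr_ge0 // -subr_ge0.
  have -> : 3 - 4 / (n%:R + 3) - (3 - 4 / (n%:R + 2) + 4 / (n%:R + 3) ^+ 2)
     = 4 / ((n%:R + 2) * (n%:R + 3) ^+ 2) :> rat.
    by field; apply/andP; split; lra.
  by rewrite divr_ge0 // mulr_ge0 ?sqr_ge0 //; lra.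
case: N N0 H => [//|[|N]] _ H; first by rewrite big_geq.
rewrite -(ler_nat rat) (natrM _ 4) (natrM _ 3) natr_sum.
apply: (le_trans (H N)); rewrite natrX [leRHS]mulrC ler_wpM2l ?sqr_ge0 // gerBl.
by rewrite divr_ge0.
Qed.

(** Union bound: a pair that is not coprime has a common divisor d in [2, N], namely its gcd, and (N
    %/ d) ^ 2 pairs have both entries divisible by d. *)
Lemma card_coprime_pairs (N : nat) : (0 < N)%N ->
  (N ^ 2 <= 4 * #|[set x : 'I_N * 'I_N | coprime x.1.+1 x.2.+1]|)%N.
Proof.
move=> N0.
suff : (N ^ 2 <= #|[set x : 'I_N * 'I_N | coprime x.1.+1 x.2.+1]|
    + \sum_(2 <= d < N.+1) (N %/ d) ^ 2)%N.
  by have := sum_divn_sqr N N0; lia.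
have -> : (N ^ 2 = \sum_(x : 'I_N * 'I_N) 1)%N.
  by rewrite sum1_card card_prod card_ord mulnn.
have -> : (\sum_(2 <= d < N.+1) (N %/ d) ^ 2 =
   \sum_(x : 'I_N * 'I_N) \sum_(2 <= d < N.+1) (d %| x.1.+1) * (d %| x.2.+1))%N.
  rewrite exchange_big /=; apply: eq_bigr => d _.
  rewrite -(pair_bigA _ (fun i j : 'I_N => (d %| i.+1) * (d %| j.+1)))%N /=.
  under eq_bigr do rewrite -big_distrr /=.
  by rewrite -big_distrl /= -mulnn divn_count_dvd big_add1 big_mkord.
rewrite -sum1_card [X in (_ <= X + _)%N]big_mkcond /=.
rewrite -big_split /=; apply: leq_sum => -[a b] _ /=; rewrite inE /=.
case: ifP => // /negbT ab; rewrite add0n.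
have g0 : (0 < gcdn a.+1 b.+1)%N by rewrite gcdn_gt0.
rewrite (bigD1_seq (gcdn a.+1 b.+1)) ?iota_uniq //=.
  by rewrite dvdn_gcdl dvdn_gcdr.
rewrite mem_index_iota ltn_neqAle eq_sym ab g0 /= ltnS.
exact: leq_trans (dvdn_leq _ (dvdn_gcdl _ _)) (ltn_ord a).
Qed.

(** Moves the count to the field where the quotients a / b live. The cast is there because the bound
    of the ordinal type ['F_p] is only provably equal to p. *)
Lemma eta0E (p : nat) : prime p ->
  eta0 p = #|[set x : 'F_p | (mirimanoff p).[x] == 0]|.
Proof.
move=> p_pr; rewrite /eta0.
rewrite -(card_imset _ (@cast_ord_inj _ _ (Fp_cast p_pr))).
apply: eq_card => c; rewrite inE; apply/idP/imsetP => [c0|[x + ->]].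
  exists (cast_ord (esym (Fp_cast p_pr)) c); last by rewrite cast_ordKV.
  by rewrite inE -[cast_ord _ _]natr_Zp.
by rewrite inE /= natr_Zp.
Qed.

Lemma kappa_eta0 (p : nat) (p_pr : prime p) : odd p ->
  ((kappa p_pr).-1 ^ 2 <= 4 * eta0 p)%N.
Proof.
move=> p_odd; set N := (kappa p_pr).-1.
have k1 := kappa_gt1 p p_pr.
have p3 : (2 < p)%N by rewrite odd_prime_gt2.
have Np : (N ^ 2 <= p)%N by exact: kappa_pred_sqr.
have N0 : (0 < N)%N by rewrite /N; lia.
have Nltp : (N < p)%N by nia.
have Nk : (N < kappa p_pr)%N by rewrite /N; lia.
apply: leq_trans (card_coprime_pairs N N0) _; rewrite leq_mul2l eta0E //=.
have nz n : (0 < n < p)%N -> n%:R != 0 :> 'F_p.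
  by case/andP=> n0 np; rewrite -(dvdn_pcharf (pchar_Fp p_pr)) gtnNdvd.
pose f (x : 'I_N * 'I_N) : 'F_p := x.1.+1%:R / x.2.+1%:R.
rewrite -(@card_in_imset _ _ f); last first.
  move=> [a b] [c d]; rewrite !inE /= => ab cd /eqP; rewrite /f /=.
  have [aN bN cN dN] := And4 (ltn_ord a) (ltn_ord b) (ltn_ord c) (ltn_ord d).
  rewrite eqr_div ?nz //; try lia.
  rewrite -!natrM => /eqP/(congr1 val); rewrite /= !val_Fp_nat // => adcb.
  have {}adcb : (a.+1 * d.+1 = c.+1 * b.+1)%N.
    have h1 : (a.+1 * d.+1 <= p)%N by nia.
    have h2 : (c.+1 * b.+1 <= p)%N by nia.
    (* The bounds allow a product equal to p, whose residue is 0. The predecessors are below p, so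
       for them congruence is equality. *)
    rewrite -(prednK (muln_gt0 a.+1 d.+1)) in adcb h1 *.
    rewrite -(prednK (muln_gt0 c.+1 b.+1)) in adcb h2 *.
    move/eqP: adcb; rewrite -!(addn1 _.-1) eqn_modDr !modn_small //.
    by move/eqP=> ->.
  (* Both fractions are in lowest terms, so by Gauss's lemma the numerators divide each other. *)
  have ac : a.+1 = c.+1.
    apply/eqP; rewrite eqn_dvd -(Gauss_dvdl _ ab) -adcb dvdn_mulr //=.
    by rewrite -(Gauss_dvdl _ cd) adcb dvdn_mulr.
  have bd : b.+1 = d.+1.
    by move: adcb; rewrite ac => /eqP; rewrite eqn_pmul2l // => /eqP.
  by congr pair; apply: val_inj; [case: ac | case: bd].
apply/subset_leq_card/subsetP => _ /imsetP[[a b] ab ->]; rewrite inE /f /=.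
have [aN bN] := conj (ltn_ord a) (ltn_ord b).
apply/eqP; rewrite -[a.+1%:R]/(a.+1%:Z%:~R) -[b.+1%:R]/(b.+1%:Z%:~R).
apply: root_mirimanoff => //.
  by rewrite dvdzE /= gtnNdvd //; lia.
have fix_ x : (0 < x <= N)%N -> ((p ^ 2)%N%:Z %| x%:Z ^+ p - x%:Z)%Z.
  by move=> xm; apply: (@fermat_lt_kappa _ p_pr); lia.
(* [B - A] may be zero or negative; for odd p, x ^ p - x is an odd function of x. *)
have fixz (x : int) : (`|x| <= N)%N -> ((p ^ 2)%N%:Z %| x ^+ p - x)%Z.
  case: x => [[|n]|n] xN.
  - by rewrite expr0n; case: (p) p3.
  - exact: fix_.
  rewrite NegzE exprNn -signr_odd p_odd expr1 mulN1r -opprD rpredN.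
  exact: fix_.
set A := a.+1%:Z; set B := b.+1%:Z.
have -> : (B - A) ^+ p - B ^+ p + A ^+ p =
  ((B - A) ^+ p - (B - A)) - (B ^+ p - B) + (A ^+ p - A) by ring.
by apply: rpredD; [apply: rpredB |]; apply: fixz; rewrite /A /B; lia.
Qed.

Theorem theorem1 (R : realType) :
  exists C : R, 0 < C /\
    forall (p : nat) (p_pr : prime p), odd p ->
      (kappa p_pr)%:R <= C * Num.sqrt (eta0 p)%:R.
Proof.
(* As kappa_p >= 2, kappa_p <= 2 (kappa_p - 1), so kappa_p ^ 2 <= 4 * 4 eta_0. *)
exists 4; split => // p p_pr p_odd.
have k1 := kappa_gt1 p p_pr; have kE := kappa_eta0 p p_pr p_odd.
have kE16 : (kappa p_pr ^ 2 <= 4 ^ 2 * eta0 p)%N by nia.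
rewrite -(ger0_norm (ler0n R (kappa p_pr))) -sqrtr_sqr.
rewrite -[leRHS]ger0_norm ?mulr_ge0 ?sqrtr_ge0 //.
rewrite -[leRHS]sqrtr_sqr ler_wsqrtr // exprMn sqr_sqrtr ?ler0n //.
by rewrite -!natrX -natrM ler_nat.
Qed.
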